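(* Let $p=(3+\sqrt3)/6$ and consider the following fully explicit single-solve algorithm (Algorithm 1) for $M\ddot u=f(\dot u,u,t)$ with time step $\Delta t$: $$\dot u_{n+p}=\dot u_n+p\Delta t\,\ddot u_n,\qquad u_{n+p}=u_n+p\Delta t\,\dot u_n+\tfrac{p^2}{2}\Delta t^2\,\ddot u_n,\qquad M\ddot u_{n+p}=f(\dot u_{n+p},u_{n+p},t_n+p\Delta t),$$ $$u_{n+1}=u_n+\Delta t\,\dot u_n+\Delta t^2\Big(\tfrac{6p^2-1}{12p}\ddot u_n+\tfrac{-6p^2+6p+1}{12p}\ddot u_{n+p}\Big),$$ $$\dot u_{n+1}=\dot u_n+\Delta t\Big(\tfrac{2p-1}{2p}\ddot u_n+\tfrac1{2p}\ddot u_{n+p}\Big),\qquad \ddot u_{n+1}=\tfrac{p-1}{p}\ddot u_n+\tfrac1p\ddot u_{n+p}.$$ Applied to the test equation $\ddot u+2\xi\omega\dot u+\omega^2u=f(t)$ with $\omega\in(0,\infty)$ and $f\in C^\infty(\mathbb R)$, this algorithm is third-order accurate in displacement and in velocity and second-order accurate in acceleration when $\xi=0$ (that is, $\tau_u=\mathcal O(\Delta t^3)$, $\tau_{\dot u}=\mathcal O(\Delta t^3)$, $\tau_{\ddot u}=\mathcal O(\Delta t^2)$). It has identical second-order accuracy (all three components of $\tau$ are $\mathcal O(\Delta t^2)$) when $\xi\in(0,1)$.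
   Context: **One-step form.** For the scalar test equation $\ddot u(t)+2\xi\omega\dot u(t)+\omega^2u(t)=f(t)$, $\xi\in[0,1)$, $\omega\in(0,\infty)$, $f\in C^\infty(\mathbb R)$ (so $M=1$ and the force is $f(t)-2\xi\omega\dot u-\omega^2u$), the algorithm maps $X_n=(u_n,\dot u_n,\ddot u_n)^{\mathsf T}$ at $t_n$ to $X_{n+1}$ at $t_n+\Delta t$ in the form $$X_{n+1}=D_{\rm num}X_n+L_{\rm num}(t_n).$$ Here $D_{\rm num}$ is the $3\times3$ matrix collecting the dependence on $X_n$, and $L_{\rm num}(t_n)$ is the vector collecting the terms containing $f(t_n+p\Delta t)$, obtained by eliminating $\ddot u_{n+p}$ from the defining relations. **Order of accuracy.** Let $\det(\lambda I_3-D_{\rm num})=\sum_{j=0}^3A_j\lambda^j$ (so $A_3=1$; the $A_j$ depend on $\Delta t$). For an exact solution $u$ of the test equation put $X(t)=(u(t),\dot u(t),\ddot u(t))^{\mathsf T}$ and $t_{n+i}=t_n+i\Delta t$. The local truncation error vector is $$\tau=(\tau_u,\tau_{\dot u},\tau_{\ddot u})^{\mathsf T}=\frac1{\Delta t^2}\Big(\sum_{i=0}^3A_iX(t_{n+i})-\sum_{i=0}^3A_i\sum_{j=0}^{i-1}D_{\rm num}^{\,j}L_{\rm num}(t_{n-j+i-1})\Big).$$ The algorithm is $r$-th-order accurate in displacement (resp. velocity, acceleration) if $\tau_u=\mathcal O(\Delta t^r)$ (resp. $\tau_{\dot u}$, $\tau_{\ddot u}$) as $\Delta t\to0$, for every $f\in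 C^\infty(\mathbb R)$, every exact solution $u$ and every $t_n$, with $\omega,\xi$ fixed. It has identical $r$-th-order accuracy if all three components are $\mathcal O(\Delta t^r)$. *)

(* Defs.v *)
From HB Require Import structures.
From mathcomp Require Import all_boot all_order all_algebra.
From mathcomp Require Import all_classical all_reals all_analysis.
From mathcomp Require Import ring.
Set Implicit Arguments.
Unset Strict Implicit.
Unset Printing Implicit Defensive.
Import Order.TTheory GRing.Theory Num.Theory.
Import numFieldNormedType.Exports.
Local Open Scope classical_set_scope.
Local Open Scope ring_scope.

(* (u, du/dt, d2u/dt2) as a column vector; in 'I_3, the indices 0, 1 and 2
   stand for displacement, velocity and acceleration. *)
Definition state (R : realType) (u v a : R) : 'cV[R]_3 :=
  \col_i [:: u; v; a]`_i.

Definition disp : 'I_3 := 0.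
Definition velo : 'I_3 := 1.
Definition acce : 'I_3 := 2.

(* One step, from X at time t to time t + dt, for the scalar problem
   M * u'' = F u' u t with M != 0; ap is the acceleration at t + p * dt. *)
Definition alg1_step (R : realType) (p M : R) (F : R -> R -> R -> R)
    (dt t : R) (X : 'cV[R]_3) : 'cV[R]_3 :=
  let u := X disp 0 in
  let v := X velo 0 in
  let a := X acce 0 in
  let vp := v + p * dt * a in
  let up := u + p * dt * v + p ^+ 2 / 2 * dt ^+ 2 * a in
  let ap := M^-1 * F vp up (t + p * dt) in
  state
    (u + dt * v + dt ^+ 2 * ((6 * p ^+ 2 - 1) / (12 * p) * a
                             + (- 6 * p ^+ 2 + 6 * p + 1) / (12 * p) * ap))
    (v + dt * ((2 * p - 1) / (2 * p) * a + 1 / (2 * p) * ap))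
    ((p - 1) / p * a + 1 / p * ap).

Definition alg1_p (R : realType) : R := (3 + Num.sqrt 3) / 6.

Definition test_force (R : realType) (xi omega : R) (f : R -> R) (v u t : R)
  : R := f t - 2 * xi * omega * v - omega ^+ 2 * u.

Definition test_step (R : realType) (p xi omega : R) (f : R -> R) (dt t : R)
    (X : 'cV[R]_3) : 'cV[R]_3 :=
  alg1_step p 1 (test_force xi omega f) dt t X.

(* The step is affine in X. Its linear part does not involve f or t, so the
   columns of Dnum are the images of the standard basis vectors under the step
   with f = 0, taken at time 0; the remaining term Lnum is the image of X = 0.
   See test_stepE. *)
Definition Dnum (R : realType) (p xi omega dt : R) : 'M[R]_3 :=
  \matrix_(i, j) test_step p xi omega (fun=> 0) dt 0 (delta_mx j 0) i 0.

Definition Lnum (R : realType) (p xi omega : R) (f : R -> R) (dt t : R)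
  : 'cV[R]_3 := test_step p xi omega f dt t 0.

Lemma test_stepE (R : realType) (p xi omega : R) (f : R -> R) (dt t : R)
    (X : 'cV[R]_3) :
  test_step p xi omega f dt t X
  = Dnum p xi omega dt *m X + Lnum p xi omega f dt t.
Proof.
apply/matrixP => i j; rewrite ord1 !mxE !big_ord_recl big_ord0 !mxE /=.
have -> : lift ord0 (ord0 : 'I_2) = 1 :> 'I_3 by apply/val_inj.
have -> : lift ord0 (lift ord0 (ord0 : 'I_1)) = 2 :> 'I_3 by apply/val_inj.
have -> : (ord0 : 'I_3) = 0 by apply/val_inj.
rewrite /disp /velo /acce.
by case: i => [[|[|[|//]]] Hi]; rewrite /= /test_force; ring.
Qed.

Definition smooth (R : realType) (f : R -> R) : Prop :=
  forall (n : nat) (t : R), derivable (f^`(n))%classic t 1.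

Definition exact_solution (R : realType) (xi omega : R) (f u : R -> R) : Prop :=
  [/\ forall t : R, derivable u t 1,
      forall t : R, derivable (u^`())%classic t 1
    & forall t : R, (u^`(2))%classic t + 2 * xi * omega * (u^`())%classic t
                + omega ^+ 2 * u t = f t].

(* (char_poly Dnum)`_i is A_i, the coefficient of degree i of
   det(lambda I - Dnum). *)
Definition truncation_error (R : realType) (p xi omega : R) (f u : R -> R)
    (tn dt : R) : 'cV[R]_3 :=
  let D := Dnum p xi omega dt in
  let L := Lnum p xi omega f dt in
  let A (i : nat) := (char_poly D)`_i in
  let X (t : R) := state (u t) ((u^`())%classic t) ((u^`(2))%classic t) in
  (dt ^+ 2)^-1 *:
    (\sum_(0 <= i < 4) A i *: X (tn + i%:R * dt)
     - \sum_(0 <= i < 4) A i *: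
         \sum_(0 <= j < i) D ^+ j *m L (tn + (i%:R - j%:R - 1) * dt)).

(* A time step is positive, so dt tends to 0 from the right; the constant in
   the O may depend on xi, omega, f, u and tn. *)
Definition accurate (R : realType) (p xi omega : R) (i : 'I_3) (r : nat)
  : Prop :=
  forall f u : R -> R, smooth f -> exact_solution xi omega f u ->
  forall tn : R,
    (fun dt : R => truncation_error p xi omega f u tn dt i 0 : R^o)
      =O_ ((0 : R)^'+) (fun dt : R => dt ^+ r : R^o).

Definition identically_accurate (R : realType) (p xi omega : R) (r : nat)
  : Prop := forall i : 'I_3, accurate p xi omega i r.

(* Main.v *)
Require Import Defs.
From HB Require Import structures.
From mathcomp Require Import all_boot all_order all_algebra.
From mathcomp Require Import all_classical all_reals all_analysis.
From mathcomp Require Import ring.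
Import Order.TTheory GRing.Theory Num.Theory.
Import numFieldNormedType.Exports.
Local Open Scope ring_scope.
Set Implicit Arguments.
Unset Strict Implicit.
Unset Printing Implicit Defensive.

(** Write d_k for the one-step defect X(t_{k+1}) - D X(t_k) - L(t_k). By
    Cayley-Hamilton the truncation error only depends on d_0, d_1, d_2, and with
    M = I - D it equals dt^-2 times
      adj(M) d_0 + (tr(M) I - M) (d_1 - d_0) + (d_2 - 2 d_1 + d_0).
    Taylor expansion shows that the components of d_k are O(dt^4), O(dt^3) and
    O(dt^2), and that each difference in k gains a factor dt; the small entries
    of M supply the remaining powers of dt needed for second order. When xi = 0,
    the coefficients of dt^4 in the displacement and velocity components of this
    sum are u^(4) and u^(5) times
      (1/p) (1/6 - p/4) + ((2p - 1)/(2p)) (1 - p)/2 = - (6p^2 - 6p + 1)/(12p),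
    which vanishes for p = (3 + sqrt 3)/6. *)

(** * Determinants in dimension three *)

Section Det3.
Variable R : comNzRingType.
Implicit Types D : 'M[R]_3.

Lemma det3 D : \det D =
  D 0 0 * (D 1 1 * D 2 2 - D 1 2 * D 2 1)
  - D 0 1 * (D 1 0 * D 2 2 - D 1 2 * D 2 0)
  + D 0 2 * (D 1 0 * D 2 1 - D 1 1 * D 2 0).
Proof.
(* Indexing the entries by naturals lets the nested [lift]s of the two cofactor expansions compute
   to numerals, so that [ring] recognizes equal entries. *)
pose e a b := D (inord a) (inord b).
have De i j : D i j = e (val i) (val j) by rewrite /e !inord_val.
rewrite (expand_det_row _ 0) !big_ord_recl big_ord0 /cofactor.
rewrite !(expand_det_row _ ord0) !big_ord_recl !big_ord0 /cofactor.
by rewrite !det_mx11 !mxE !De /= /bump /=; ring.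
Qed.

End Det3.

(** * The truncation error as a combination of one-step defects *)

Section CharPoly3.
Variable R : comNzRingType.
Implicit Types D : 'M[R]_3.

Lemma char_poly3 D : char_poly D =
  Poly [:: - \det D;
    D 0 0 * D 1 1 + D 0 0 * D 2 2 + D 1 1 * D 2 2
      - D 0 1 * D 1 0 - D 0 2 * D 2 0 - D 1 2 * D 2 1;
    - (D 0 0 + D 1 1 + D 2 2); 1].
Proof.
rewrite /char_poly !det3 /char_poly_mx !mxE /= !cons_poly_def; ring.
Qed.

Lemma mulmx3E (D : 'M[R]_3) (v : 'cV[R]_3) i :
  (D *m v) i 0 = D i 0 * v 0 0 + D i 1 * v 1 0 + D i 2 * v 2 0.
Proof.
rewrite mxE !big_ord_recl big_ord0 addr0 addrA.
by congr (_ * _ + _ * _ + _ * _); do ?congr (_ _ _); apply/val_inj.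
Qed.

(** The defect d_k reaches X_i, for i > k, through D^(i-1-k). Weighting X_i by A_i, with A_3 = 1,
    collects the defects into this sum; A_0 is absent because X_0 carries no defect. *)
Definition defect_sum D (d0 d1 d2 : 'cV[R]_3) : 'cV[R]_3 :=
  (char_poly D)`_1 *: d0 + (char_poly D)`_2 *: (d1 + D *m d0)
  + (d2 + D *m (d1 + D *m d0)).

(** Unrolling the recurrence from [X 0], the [L] terms are exactly those subtracted, and the terms
    in [X 0] add up to the characteristic polynomial of D at D, which vanishes. *)
Lemma char_poly_sum_defect D (X L d : nat -> 'cV[R]_3) :
  (forall k, X k.+1 = D *m X k + L k + d k) ->
  \sum_(0 <= i < 4) (char_poly D)`_i *: X i
  - \sum_(0 <= i < 4) (char_poly D)`_i *:
      \sum_(0 <= j < i) D ^+ j *m L (i - j - 1)%N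
  = defect_sum D (d 0%N) (d 1%N) (d 2%N).
Proof.
rewrite /defect_sum => XS.
have /(congr1 (fun B => B *m X 0%N)) := Cayley_Hamilton D.
rewrite mul0mx => CH.
have pE : char_poly D = ((char_poly D)`_0)%:P + (char_poly D)`_1 *: 'X
    + (char_poly D)`_2 *: 'X^2 + 'X^3.
  rewrite char_poly3 !coef_Poly /= !cons_poly_def -!mul_polyC; ring.
have A3 : (char_poly D)`_3 = 1 by rewrite char_poly3 coef_Poly.
move: CH; rewrite {1}pE !rmorphD /= !linearZ /= !rmorphXn /=.
rewrite horner_mx_C horner_mx_X.
rewrite !big_nat_recr //= !big_nil !add0r A3 !XS.
rewrite -[D ^+ 0]/(1%:M) expr1 (exprSr D 2) (expr2 D) -!mulmxE !mulmxDl.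
rewrite -!scalemxAl -!mulmxA !mulmxDr !mul1mx mul_scalar_mx.
(* With all iterates turned into atoms, the two sides differ by the Cayley-Hamilton relation applied
   to [x], checked componentwise. *)
move: (X 0%N) (L 0%N) (L 1%N) (L 2%N) (d 0%N) (d 1%N) (d 2%N)
  => x l0 l1 l2 d0 d1 d2.
move: (D *m x) (D *m (D *m x)) (D *m (D *m (D *m x))) => x1 x2 x3.
move: (D *m l1) (D *m l0) (D *m (D *m l0)) => l11 l01 l02.
move: (D *m d1) (D *m d0) (D *m (D *m d0)) => d11 d01 d02 CH.
apply/colP => i; have /colP/(_ i) := CH; rewrite !mxE => {}CH.
by apply: subr0_eq; rewrite -[RHS]CH; ring.
Qed.

(** Substituting d1 = d0 + e and d2 = d0 + 2 e + ee turns the coefficients into adj(M), tr(M) I - M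
    and I. In this form the powers of the step coming from M and from the differences can be counted
    term by term. *)
Lemma defect_sum3E D (d0 d1 d2 : 'cV[R]_3)
    (S := defect_sum D d0 d1 d2)
    (M := 1%:M - D) (e := fun i => d1 i 0 - d0 i 0)
    (ee := fun i => d2 i 0 - 2 * d1 i 0 + d0 i 0) :
  [/\ S 0 0 = (M 1 1 * M 2 2 - M 1 2 * M 2 1) * d0 0 0
              - (M 0 1 * M 2 2 - M 0 2 * M 2 1) * d0 1 0
              + (M 0 1 * M 1 2 - M 0 2 * M 1 1) * d0 2 0
              + (M 1 1 + M 2 2) * e 0 - M 0 1 * e 1 - M 0 2 * e 2 + ee 0,
      S 1 0 = - (M 1 0 * M 2 2 - M 1 2 * M 2 0) * d0 0 0
              + (M 0 0 * M 2 2 - M 0 2 * M 2 0) * d0 1 0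
              - (M 0 0 * M 1 2 - M 0 2 * M 1 0) * d0 2 0
              - M 1 0 * e 0 + (M 0 0 + M 2 2) * e 1 - M 1 2 * e 2 + ee 1 &
      S 2 0 = (M 1 0 * M 2 1 - M 1 1 * M 2 0) * d0 0 0
              - (M 0 0 * M 2 1 - M 0 1 * M 2 0) * d0 1 0
              + (M 0 0 * M 1 1 - M 0 1 * M 1 0) * d0 2 0
              - M 2 0 * e 0 - M 2 1 * e 1 + (M 0 0 + M 1 1) * e 2 + ee 2].
Proof.
rewrite /S /M /e /ee /defect_sum char_poly3 !coef_Poly /=.
by split; rewrite !(mulmx3E, mxE) /=; ring.
Qed.

End CharPoly3.

(** * Calculus of one-sided orders at 0 *)

Section BigO.
Local Open Scope classical_set_scope.
Variable R : realType.
Implicit Types (f g : R -> R) (m n : nat).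

(** Keeping the exponent as a parameter lets the order of a compound expression be synthesized by
    unification from those of its parts. *)
Definition isBigO n f : Prop :=
  exists C : R, \forall h \near 0^'+, `|f h| <= C * h ^+ n.

Lemma isBigO_ext n f g : f =1 g -> isBigO n g -> isBigO n f.
Proof. by move=> /funext ->. Qed.

Lemma isBigOW m n f : (n <= m)%N -> isBigO m f -> isBigO n f.
Proof.
move=> le_nm [C Cf]; exists `|C|; near=> h.
have h0 : 0 < h by near: h; exact: nbhs_right_gt.
have h1 : h <= 1 by near: h; exact: nbhs_right_le.
have /le_trans : `|f h| <= C * h ^+ m by near: h.
apply; apply: (le_trans (ler_wpM2r _ (ler_norm C))).
  by rewrite exprn_ge0 // ltW.
by apply: ler_wpM2l => //; rewrite ler_wiXn2l // ltW.
Unshelve. all: by end_near. Qed.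

Lemma isBigOD m n f g :
  isBigO m f -> isBigO n g -> isBigO (minn m n) (fun h => f h + g h).
Proof.
move=> /(isBigOW (geq_minl m n)) [C Cf] /(isBigOW (geq_minr m n)) [K Kg].
exists (C + K); near=> h; rewrite mulrDl.
by apply: (le_trans (ler_normD _ _)); apply: lerD; near: h.
Unshelve. all: by end_near. Qed.

Lemma isBigOM m n f g :
  isBigO m f -> isBigO n g -> isBigO (m + n) (fun h => f h * g h).
Proof.
move=> [C Cf] [K Kg]; exists (C * K); near=> h.
by rewrite exprD mulrACA normrM; apply: ler_pM => //; near: h.
Unshelve. all: by end_near. Qed.

Lemma isBigON n f : isBigO n f -> isBigO n (fun h => - f h).
Proof.
by move=> [C Cf]; exists C; near=> h; rewrite normrN; near: h.
Unshelve. all: by end_near. Qed.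

Lemma isBigO_cst (c : R) : isBigO 0 (fun=> c).
Proof. by exists `|c|; apply: nearW => h; rewrite expr0 mulr1. Qed.

Lemma isBigOX n : isBigO n (fun h => h ^+ n).
Proof.
exists 1; near=> h; rewrite mul1r ger0_norm // exprn_ge0 // ltW.
Unshelve. all: by end_near. Qed.

Lemma isBigO_id : isBigO 1 (fun h => h).
Proof. exact: (isBigOX 1). Qed.

Lemma isBigO_eqO n m f (g : R -> R) : isBigO (m + n) f ->
  (forall h, g h = (h ^+ m)^-1 * f h) ->
  (g : R -> R^o) =O_ (0^'+) (fun h : R => h ^+ n : R^o).
Proof.
move=> [C Cf] gE; apply/eqO_exP; exists (`|C| + 1); first by rewrite ltr_wpDl.
near=> h; rewrite gE.
have h0 : 0 < h by near: h; exact: nbhs_right_gt.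
have hm : 0 < h ^+ m by rewrite exprn_gt0.
rewrite normrM normfV (gtr0_norm hm) [X in _ <= _ * X]gtr0_norm ?exprn_gt0 //.
rewrite ler_pdivrMl //.
have fh : `|f h| <= C * h ^+ (m + n) by near: h.
rewrite (le_trans fh) // exprD mulrCA ler_pM2l // ler_pM2r ?exprn_gt0 //.
by rewrite (le_trans (ler_norm _)) // lerDl.
Unshelve. all: by end_near. Qed.

End BigO.

(** * Taylor polynomials and their remainders *)

Section Taylor.
Local Open Scope classical_set_scope.
Variable R : realType.
Implicit Types (g : R -> R) (t : R) (n : nat).

(** The variable is the increment from [t], and only degrees below [n] occur, so the remainder has
    order [n]. *)
Definition taylor n g t : {poly R} :=
  \poly_(m < n) ((g^`(m))%classic t / m`!%:R).

Lemma derive1Sn g n : ((g^`())^`(n) = g^`(n.+1))%classic.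
Proof. by rewrite /derive1n iterSr. Qed.

Lemma smooth_derive1 g : smooth g -> smooth (g^`())%classic.
Proof. by move=> sg n t; rewrite derive1Sn; exact: sg. Qed.

Lemma deriv_taylor n g t :
  deriv (taylor n.+1 g t) = taylor n (g^`())%classic t.
Proof.
apply/polyP => i; rewrite coef_deriv !coef_poly ltnS; case: ifP => // _.
  rewrite derive1Sn factS natrM -mulr_natr.
  by field; rewrite nat1r !pnatr_eq0 -lt0n fact_gt0.
by rewrite mul0rn.
Qed.

Lemma is_derive_taylor_rem n g t (y : R) : smooth g ->
  is_derive y 1 (fun z => g (t + z) - (taylor n.+1 g t).[z])
    ((g^`())%classic (t + y) - (taylor n (g^`())%classic t).[y]).
Proof.
move=> sg; apply: is_deriveB.
  have -> : (fun z => g (t + z)) = g \o (fun z => t + z) by [].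
  rewrite -[X in is_derive _ _ _ X]mulr1; apply: is_derive1_comp.
    by rewrite derive1E; apply: DeriveDef => //; exact: (sg 0%N).
  rewrite -[X in is_derive _ _ _ X]add0r; apply: is_deriveD.
apply: DeriveDef; first exact: derivable_horner.
by rewrite -derive1E -derivE deriv_taylor.
Qed.

(** Induction on [n]: the remainder of g at order n + 1 vanishes at 0 and its derivative is the
    remainder of g' at order n, so the mean value theorem gains a factor x with the same constant.
    At order 0 the polynomial is zero, and continuity bounds g near t by |g t| + 1. *)
Lemma taylor_bound n g t : smooth g ->
  exists C e : R, [/\ 0 <= C, 0 < e & forall x : R, 0 <= x < e ->
    `|g (t + x) - (taylor n g t).[x]| <= C * x ^+ n].
Proof.
elim: n g => [|n IHn] g sg.
  have : {for t, continuous g}.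
    exact/differentiable_continuous/derivable1_diffP/(sg 0%N).
  move=> /cvgrPdist_le /(_ 1 ltr01) /nbhs_ballP[e /= e0 ge].
  exists (`|g t| + 1), e; split=> // x /andP[x0 xe].
  rewrite expr0 mulr1 [X in X.[x]](_ : _ = 0).
    rewrite horner0 subr0 -[X in `|X|](addrNK (g t)) addrC.
    rewrite (le_trans (ler_normD _ _)) // lerD2l distrC; apply: ge.
    by rewrite /ball /= opprD addrA subrr add0r normrN ger0_norm.
  by apply/polyP => i; rewrite coef_poly coef0.
have [C [e [C0 e0 Ce]]] := IHn _ (smooth_derive1 sg).
exists C, e; split=> // x /andP[x0 xe].
have dphiE y := is_derive_taylor_rem n t y sg.
have [|c] := @MVT_segment R _ _ 0 x x0 (fun y _ => dphiE y).
  by apply: derivable_within_continuous => y _; have [] := dphiE y.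
rewrite in_itv /= => /andP[c0 cx].
have phi0 : g (t + 0) - (taylor n.+1 g t).[0] = 0.
  by rewrite addr0 horner_coef0 coef_poly /= divr1 subrr.
rewrite phi0 !subr0 => ->.
rewrite normrM (ger0_norm x0) exprSr mulrA ler_wpM2r //.
have le_c :
  `|(g^`())%classic (t + c) - (taylor n (g^`())%classic t).[c]|
    <= C * c ^+ n by apply: Ce; rewrite c0 (le_lt_trans cx).
by rewrite (le_trans le_c) // ler_wpM2l // lerXn2r.
Qed.

(** The node position [s] is counted in steps; all nodes are expanded about the same [t], so that
    defects of successive steps can be subtracted. *)
Definition taylor_rem n g t (s h : R) := g (t + s * h) - (taylor n g t).[s * h].

Lemma isBigO_taylor_rem n g t s : smooth g -> 0 <= s ->
  isBigO n (taylor_rem n g t s).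
Proof.
move=> sg s0; have [C [e [C0 e0 Ce]]] := taylor_bound n t sg.
exists (C * s ^+ n); near=> h; rewrite -mulrA -exprMn; apply: Ce.
have h0 : 0 < h by near: h; exact: nbhs_right_gt.
rewrite mulr_ge0 ?(ltW h0) //=.
(* Dividing by s + 1 rather than s also covers s = 0. *)
have : h < e / (s + 1).
  by near: h; apply: nbhs_right_lt; rewrite divr_gt0 // ltr_wpDl.
rewrite ltr_pdivlMr ?ltr_wpDl // => /(le_lt_trans _); apply.
by rewrite mulrC ler_pM2l // lerDl.
Unshelve. all: by end_near. Qed.

End Taylor.

(** * Smoothness of exact solutions *)

Section Regularity.
Variable R : realType.

Lemma is_derive1n (g : R -> R) n t : derivable (g^`(n))%classic t 1 ->
  is_derive t 1 (g^`(n))%classic ((g^`(n.+1))%classic t).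
Proof. by move=> dg; rewrite derive1nS derive1E; exact: DeriveDef. Qed.

(** Bootstrapping: the equation expresses u'' through f, u and u', so each differentiation of it
    yields one more derivative of u. The induction carries two consecutive orders of derivability
    and the equation differentiated k times. *)
Lemma exact_solution_smooth (xi omega : R) (f u : R -> R) :
  smooth f -> exact_solution xi omega f u -> smooth u.
Proof.
move=> sf [du0 du1 ode].
suff H k : [/\ forall t : R, derivable (u^`(k))%classic t 1,
    forall t : R, derivable (u^`(k.+1))%classic t 1 &
    (u^`(k.+2))%classic = fun t => (f^`(k))%classic t
      - (2 * xi * omega) * (u^`(k.+1))%classic t - omega ^+ 2 * (u^`(k))%classic t].
  by move=> k; have [] := H k.
elim: k => [|k [d0 d1 uE]].
  split=> //; apply/funext => t.
  rewrite -[(f^`(0))%classic t]ode -[(u^`(1))%classic]/(u^`())%classic.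
  by rewrite -[(u^`(0))%classic]/u; ring.
have dE (t : R) : is_derive t 1 (u^`(k.+2))%classic ((f^`(k.+1))%classic t
      - (2 * xi * omega) * (u^`(k.+2))%classic t - omega ^+ 2 * (u^`(k.+1))%classic t).
  rewrite [X in is_derive _ _ X _]uE.
  apply: is_deriveB; first apply: is_deriveB.
  - exact: (is_derive1n (sf k t)).
  - have := is_deriveZ (2 * xi * omega) (is_derive1n (d1 t)); exact.
  - have := is_deriveZ (omega ^+ 2) (is_derive1n (d0 t)); exact.
split; [exact: d1| |]; first by move=> t; have [] := dE t.
by apply/funext => t; rewrite derive1nS derive1E; have [_ ->] := dE t.
Qed.

End Regularity.

(* Atoms are matched syntactically: conversion would unfold the derivatives. *)
Ltac isBigO_infer :=
  match goal with
  | H : isBigO _ ?f |- isBigO _ ?g => constr_eq f g; exact: H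
  | H : isBigO _ ?f |- isBigO _ (fun h => ?g h) => constr_eq f g; exact: H
  | _ => lazymatch goal with
    | |- isBigO _ (fun h => h) => exact: isBigO_id
    | |- isBigO _ (fun h => h ^+ _) => exact: isBigOX
    | |- isBigO _ (fun=> ?c) => exact: isBigO_cst
    | |- isBigO _ (fun h => @?f h + @?g h) =>
        eapply (@isBigOD _ _ _ f g); isBigO_infer
    | |- isBigO _ (fun h => - @?f h) => eapply (@isBigON _ _ f); isBigO_infer
    | |- isBigO _ (fun h => @?f h * @?g h) =>
        eapply (@isBigOM _ _ _ f g); isBigO_infer
    end
  end.
(** The exponent found by inference is built from numerals with [minn] and addition, so its
    comparison with the requested one is a computation. *)
Ltac isBigO_auto := eapply isBigOW; last isBigO_infer; done.

(** * Power counting in the combination of defects *)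

Section DefectSum.
Variables (R : realType) (D : R -> 'M[R]_3) (d : nat -> R -> 'cV[R]_3).
Variables (a b cu cv cv' cv1 ca ca' ca1 : R).
Let M h := 1%:M - D h.

Hypotheses (M_disp : [/\ isBigO 2 (fun h => M h 0 0), isBigO 1 (fun h => M h 1 0)
    & isBigO 0 (fun h => M h 2 0)])
  (M_velo : [/\ isBigO 2 (fun h => M h 0 1 + h), isBigO 1 (fun h => M h 1 1)
    & isBigO 0 (fun h => M h 2 1)])
  (M_acce : [/\ isBigO 2 (fun h => M h 0 2), isBigO 2 (fun h => M h 1 2 + b * h)
    & isBigO 1 (fun h => M h 2 2 - a)]).
(** [cv'] and [ca'] play the part of the time derivatives of [cv] and [ca]: moving the base point by
    k steps changes the coefficients by k h times these. Hence they alone lead the first differences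
    in k, and second differences cancel them. *)
Hypotheses
  (d_disp : forall k, isBigO 5 (fun h => d k h 0 0 - h ^+ 4 * cu))
  (d_velo : forall k,
    isBigO 5 (fun h => d k h 1 0 - h ^+ 3 * (cv + h * (cv1 + k%:R * cv'))))
  (d_acce : forall k,
    isBigO 4 (fun h => d k h 2 0 - h ^+ 2 * (ca + h * (ca1 + k%:R * ca')))).

Lemma disp_orders :
  [/\ isBigO 4 (fun h => d 0 h 0 0),
      isBigO 5 (fun h => d 1 h 0 0 - d 0 h 0 0)
    & isBigO 5 (fun h => d 2 h 0 0 - 2 * d 1 h 0 0 + d 0 h 0 0)].
Proof.
have H0 := d_disp 0; have H1 := d_disp 1; have H2 := d_disp 2; split.
- apply: (@isBigO_ext _ _ _ (fun h => (d 0 h 0 0 - h ^+ 4 * cu) + h ^+ 4 * cu)).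
    by move=> h; ring.
  isBigO_auto.
- apply: (@isBigO_ext _ _ _ (fun h => (d 1 h 0 0 - h ^+ 4 * cu)
    - (d 0 h 0 0 - h ^+ 4 * cu))); first by move=> h; ring.
  isBigO_auto.
- apply: (@isBigO_ext _ _ _ (fun h => (d 2 h 0 0 - h ^+ 4 * cu)
    - 2 * (d 1 h 0 0 - h ^+ 4 * cu) + (d 0 h 0 0 - h ^+ 4 * cu))).
    by move=> h; ring.
  isBigO_auto.
Qed.

Lemma velo_orders :
  [/\ isBigO 4 (fun h => d 0 h 1 0 - h ^+ 3 * cv),
      isBigO 5 (fun h => d 1 h 1 0 - d 0 h 1 0 - h ^+ 4 * cv')
    & isBigO 5 (fun h => d 2 h 1 0 - 2 * d 1 h 1 0 + d 0 h 1 0)].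
Proof.
have H0 := d_velo 0; have H1 := d_velo 1; have H2 := d_velo 2; split.
- apply: (@isBigO_ext _ _ _ (fun h =>
    (d 0 h 1 0 - h ^+ 3 * (cv + h * (cv1 + 0%:R * cv'))) + h ^+ 4 * cv1)).
    by move=> h; ring.
  isBigO_auto.
- apply: (@isBigO_ext _ _ _ (fun h =>
    (d 1 h 1 0 - h ^+ 3 * (cv + h * (cv1 + 1%:R * cv')))
    - (d 0 h 1 0 - h ^+ 3 * (cv + h * (cv1 + 0%:R * cv'))))).
    by move=> h; ring.
  isBigO_auto.
- apply: (@isBigO_ext _ _ _ (fun h =>
    (d 2 h 1 0 - h ^+ 3 * (cv + h * (cv1 + 2%:R * cv')))
    - 2 * (d 1 h 1 0 - h ^+ 3 * (cv + h * (cv1 + 1%:R * cv')))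
    + (d 0 h 1 0 - h ^+ 3 * (cv + h * (cv1 + 0%:R * cv'))))).
    by move=> h; ring.
  isBigO_auto.
Qed.

Lemma acce_orders :
  [/\ isBigO 3 (fun h => d 0 h 2 0 - h ^+ 2 * ca),
      isBigO 4 (fun h => d 1 h 2 0 - d 0 h 2 0 - h ^+ 3 * ca')
    & isBigO 4 (fun h => d 2 h 2 0 - 2 * d 1 h 2 0 + d 0 h 2 0)].
Proof.
have H0 := d_acce 0; have H1 := d_acce 1; have H2 := d_acce 2; split.
- apply: (@isBigO_ext _ _ _ (fun h =>
    (d 0 h 2 0 - h ^+ 2 * (ca + h * (ca1 + 0%:R * ca'))) + h ^+ 3 * ca1)).
    by move=> h; ring.
  isBigO_auto.
- apply: (@isBigO_ext _ _ _ (fun h =>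
    (d 1 h 2 0 - h ^+ 2 * (ca + h * (ca1 + 1%:R * ca')))
    - (d 0 h 2 0 - h ^+ 2 * (ca + h * (ca1 + 0%:R * ca'))))).
    by move=> h; ring.
  isBigO_auto.
- apply: (@isBigO_ext _ _ _ (fun h =>
    (d 2 h 2 0 - h ^+ 2 * (ca + h * (ca1 + 2%:R * ca')))
    - 2 * (d 1 h 2 0 - h ^+ 2 * (ca + h * (ca1 + 1%:R * ca')))
    + (d 0 h 2 0 - h ^+ 2 * (ca + h * (ca1 + 0%:R * ca'))))).
    by move=> h; ring.
  isBigO_auto.
Qed.

Let defsum (h : R) := defect_sum (D h) (d 0 h) (d 1 h) (d 2 h).

(** Order 4 follows by counting powers. In displacement the only terms of exact weight 4 are - M01
    M22 d0_1 + M01 M12 d0_2, with leading part h^4 (a cv + b ca); in velocity they are M22 e_1 - M12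
    e_2, with leading part h^4 (a cv' + b ca'). *)
Lemma defect_sum_orders :
  [/\ [/\ isBigO 4 (fun h => defsum h 0 0), isBigO 4 (fun h => defsum h 1 0)
        & isBigO 4 (fun h => defsum h 2 0)],
      a * cv + b * ca = 0 -> isBigO 5 (fun h => defsum h 0 0)
    & a * cv' + b * ca' = 0 -> isBigO 5 (fun h => defsum h 1 0)].
Proof.
have [M00 M10 M20] := M_disp; have [N01 M11 M21] := M_velo.
have [M02 N12 N22] := M_acce.
have SE h := defect_sum3E (D h) (d 0 h) (d 1 h) (d 2 h).
have [u0 u1 u2] := disp_orders.
have [w0 w1 v2] := velo_orders; have [b0 b1 a2] := acce_orders.
have M01 : isBigO 1 (fun h => M h 0 1).
  apply: (@isBigO_ext _ _ _ (fun h => (M h 0 1 + h) - h)) => [h|]; [ring|isBigO_auto].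
have M12 : isBigO 1 (fun h => M h 1 2).
  apply: (@isBigO_ext _ _ _ (fun h => (M h 1 2 + b * h) - b * h)) => [h|];
    [ring|isBigO_auto].
have M22 : isBigO 0 (fun h => M h 2 2).
  apply: (@isBigO_ext _ _ _ (fun h => (M h 2 2 - a) + a)) => [h|]; [ring|isBigO_auto].
have v0 : isBigO 3 (fun h => d 0 h 1 0).
  apply: (@isBigO_ext _ _ _ (fun h => (d 0 h 1 0 - h ^+ 3 * cv) + h ^+ 3 * cv)) => [h|];
    [ring|isBigO_auto].
have v1 : isBigO 4 (fun h => d 1 h 1 0 - d 0 h 1 0).
  apply: (@isBigO_ext _ _ _ (fun h =>
    (d 1 h 1 0 - d 0 h 1 0 - h ^+ 4 * cv') + h ^+ 4 * cv')) => [h|]; [ring|isBigO_auto].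
have a0 : isBigO 2 (fun h => d 0 h 2 0).
  apply: (@isBigO_ext _ _ _ (fun h => (d 0 h 2 0 - h ^+ 2 * ca) + h ^+ 2 * ca)) => [h|];
    [ring|isBigO_auto].
have a1 : isBigO 3 (fun h => d 1 h 2 0 - d 0 h 2 0).
  apply: (@isBigO_ext _ _ _ (fun h =>
    (d 1 h 2 0 - d 0 h 2 0 - h ^+ 3 * ca') + h ^+ 3 * ca')) => [h|]; [ring|isBigO_auto].
split; first split.
- apply: (@isBigO_ext _ _ _ (fun h =>
    (M h 1 1 * M h 2 2 - M h 1 2 * M h 2 1) * d 0 h 0 0
    - (M h 0 1 * M h 2 2 - M h 0 2 * M h 2 1) * d 0 h 1 0
    + (M h 0 1 * M h 1 2 - M h 0 2 * M h 1 1) * d 0 h 2 0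
    + (M h 1 1 + M h 2 2) * (d 1 h 0 0 - d 0 h 0 0)
    - M h 0 1 * (d 1 h 1 0 - d 0 h 1 0) - M h 0 2 * (d 1 h 2 0 - d 0 h 2 0)
    + (d 2 h 0 0 - 2 * d 1 h 0 0 + d 0 h 0 0))).
    by move=> h; rewrite /defsum; have [-> _ _] := SE h.
  isBigO_auto.
- apply: (@isBigO_ext _ _ _ (fun h =>
    - (M h 1 0 * M h 2 2 - M h 1 2 * M h 2 0) * d 0 h 0 0
    + (M h 0 0 * M h 2 2 - M h 0 2 * M h 2 0) * d 0 h 1 0
    - (M h 0 0 * M h 1 2 - M h 0 2 * M h 1 0) * d 0 h 2 0
    - M h 1 0 * (d 1 h 0 0 - d 0 h 0 0)
    + (M h 0 0 + M h 2 2) * (d 1 h 1 0 - d 0 h 1 0)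
    - M h 1 2 * (d 1 h 2 0 - d 0 h 2 0)
    + (d 2 h 1 0 - 2 * d 1 h 1 0 + d 0 h 1 0))).
    by move=> h; rewrite /defsum; have [_ -> _] := SE h.
  isBigO_auto.
- apply: (@isBigO_ext _ _ _ (fun h =>
    (M h 1 0 * M h 2 1 - M h 1 1 * M h 2 0) * d 0 h 0 0
    - (M h 0 0 * M h 2 1 - M h 0 1 * M h 2 0) * d 0 h 1 0
    + (M h 0 0 * M h 1 1 - M h 0 1 * M h 1 0) * d 0 h 2 0
    - M h 2 0 * (d 1 h 0 0 - d 0 h 0 0) - M h 2 1 * (d 1 h 1 0 - d 0 h 1 0)
    + (M h 0 0 + M h 1 1) * (d 1 h 2 0 - d 0 h 2 0)
    + (d 2 h 2 0 - 2 * d 1 h 2 0 + d 0 h 2 0))).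
    by move=> h; rewrite /defsum; have [_ _ ->] := SE h.
  isBigO_auto.
- move=> cancel.
  (* [M h 0 1], [M h 1 2] and [M h 2 2] are split into leading part plus remainder; what is dropped
     is h^4 (a cv + b ca), zero by [cancel]. *)
  apply: (@isBigO_ext _ _ _ (fun h =>
    (M h 1 1 * M h 2 2 - M h 1 2 * M h 2 1) * d 0 h 0 0
    - ((M h 0 1 + h) * M h 2 2 - h * (M h 2 2 - a) - M h 0 2 * M h 2 1) * d 0 h 1 0
    + ((M h 0 1 + h) * M h 1 2 - h * (M h 1 2 + b * h) - M h 0 2 * M h 1 1)
      * d 0 h 2 0
    + (M h 1 1 + M h 2 2) * (d 1 h 0 0 - d 0 h 0 0)
    - M h 0 1 * (d 1 h 1 0 - d 0 h 1 0) - M h 0 2 * (d 1 h 2 0 - d 0 h 2 0)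
    + (d 2 h 0 0 - 2 * d 1 h 0 0 + d 0 h 0 0)
    + a * h * (d 0 h 1 0 - h ^+ 3 * cv) + b * h ^+ 2 * (d 0 h 2 0 - h ^+ 2 * ca)));
    last isBigO_auto.
  move=> h; rewrite /defsum; have [-> _ _] := SE h; rewrite -/(M h).
  apply: subr0_eq; rewrite -[RHS](mulr0 (h ^+ 4)) -cancel; ring.
- move=> cancel.
  apply: (@isBigO_ext _ _ _ (fun h =>
    - (M h 1 0 * M h 2 2 - M h 1 2 * M h 2 0) * d 0 h 0 0
    + (M h 0 0 * M h 2 2 - M h 0 2 * M h 2 0) * d 0 h 1 0
    - (M h 0 0 * M h 1 2 - M h 0 2 * M h 1 0) * d 0 h 2 0
    - M h 1 0 * (d 1 h 0 0 - d 0 h 0 0)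
    + (M h 0 0 + (M h 2 2 - a)) * (d 1 h 1 0 - d 0 h 1 0)
    - (M h 1 2 + b * h) * (d 1 h 2 0 - d 0 h 2 0)
    + (d 2 h 1 0 - 2 * d 1 h 1 0 + d 0 h 1 0)
    + a * (d 1 h 1 0 - d 0 h 1 0 - h ^+ 4 * cv')
    + b * h * (d 1 h 2 0 - d 0 h 2 0 - h ^+ 3 * ca')));
    last isBigO_auto.
  move=> h; rewrite /defsum; have [_ -> _] := SE h; rewrite -/(M h).
  apply: subr0_eq; rewrite -[RHS](mulr0 (h ^+ 4)) -cancel; ring.
Qed.

End DefectSum.

(** * The parameter p *)

Lemma alg1_p_gt0 (R : realType) : 0 < alg1_p R.
Proof. by rewrite divr_gt0 // ltr_wpDr // sqrtr_ge0. Qed.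

Lemma alg1_p_root (R : realType) : 6 * alg1_p R ^+ 2 = 6 * alg1_p R - 1.
Proof.
rewrite /alg1_p; have : Num.sqrt 3 ^+ 2 = 3 :> R by rewrite sqr_sqrtr.
by move: (Num.sqrt 3) => r rr; field: rr.
Qed.

(** * Matrix and one-step defect of the algorithm *)

Section Defect.
Variables (R : realType) (p xi omega : R).
Hypotheses (p_gt0 : 0 < p) (p_root : 6 * p ^+ 2 = 6 * p - 1).
Implicit Types (f u : R -> R).
Let c := 2 * xi * omega.
Let w := omega ^+ 2.

(* ring and field can rewrite with a relation of the form r ^+ 2 = 3, but not
   with p_root, whose leading coefficient is not 1. *)
Lemma p_rootE : exists2 r : R, r ^+ 2 = 3%:R & p = (3 + r) / 6.
Proof.
exists (6 * p - 3); last by field.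
have -> : (6 * p - 3) ^+ 2 = 6 * (6 * p ^+ 2) - 36 * p + 9 by ring.
by rewrite p_root; ring.
Qed.

(** The quadratic relation reads p * 6 (1 - p) = 1; with it all weights of the scheme become affine
    in p. *)
Lemma invr_p : p^-1 = 6 * (1 - p).
Proof.
apply: (mulfI (lt0r_neq0 p_gt0)); rewrite divff ?lt0r_neq0 //.
by have [r rr ->] := p_rootE; field: rr.
Qed.

Lemma test_stepE3 f h t (X : 'cV[R]_3) :
  let u := X 0 0 in let v := X 1 0 in let a := X 2 0 in
  let ap := f (t + p * h) - c * (v + p * h * a)
            - w * (u + p * h * v + p ^+ 2 / 2 * h ^+ 2 * a) in
  test_step p xi omega f h t X
  = state (u + h * v + h ^+ 2 * ((p - 1 / 2) * a + (1 - p) * ap))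
      (v + h * ((3 * p - 2) * a + 3 * (1 - p) * ap))
      ((6 * p - 5) * a + 6 * (1 - p) * ap).
Proof.
move=> u v a ap; rewrite /test_step /alg1_step /test_force invr1 mul1r.
rewrite -/(X disp 0) -/c -/w -/u -/v -/a -/ap.
rewrite !invfM !mul1r invr_p; move: ap => ap; have [r rr ->] := p_rootE.
congr (state (_ + _ * _) (_ + _ * _) _); by field: rr.
Qed.

Let q := 1 - p.

(** [- av] and [- aa] are the coefficients of velocity and acceleration in the stage
    acceleration. *)
Lemma Dnum3E h i (av := c + w * p * h)
    (aa := c * p * h + w * (p ^+ 2 / 2) * h ^+ 2) (D := Dnum p xi omega h) :
  [/\ D i 0 = [:: 1 - h ^+ 2 * q * w; - (h * 3 * q * w); - (6 * q * w)]`_i,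
      D i 1 = [:: h - h ^+ 2 * q * av; 1 - h * 3 * q * av; - (6 * q * av)]`_i &
      D i 2 = [:: h ^+ 2 * (p - 1 / 2 - q * aa);
        h * (3 * p - 2 - 3 * q * aa); 6 * p - 5 - 6 * q * aa]`_i].
Proof.
by split; rewrite mxE test_stepE3 !mxE /= /av /aa /q;
  case: i => [[|[|[|//]]] ?] /=; ring.
Qed.

Definition onestep_defect f (y v a : R -> R) (t h : R) : 'cV[R]_3 :=
  state (y (t + h)) (v (t + h)) (a (t + h))
  - test_step p xi omega f h t (state (y t) (v t) (a t)).

(** Eliminating f by the equation, [ap] is the stage acceleration minus [a t]. The two acceleration
    weights add up to 1/2, 1 and 1 in the three updates, which leaves Taylor terms and a multiple of
    [q * ap]. *)
Lemma onestep_defectE f (y v a : R -> R) t h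
    (ap := a (t + p * h) - a t + c * (v (t + p * h) - v t - p * h * a t)
      + w * (y (t + p * h) - y t - p * h * v t - p ^+ 2 / 2 * h ^+ 2 * a t))
    (d := onestep_defect f y v a t h) :
  (forall x, f x = a x + c * v x + w * y x) ->
  [/\ d 0 0 = y (t + h) - y t - h * v t - h ^+ 2 / 2 * a t - h ^+ 2 * q * ap,
      d 1 0 = v (t + h) - v t - h * a t - 3 * h * q * ap &
      d 2 0 = a (t + h) - a t - 6 * q * ap].
Proof.
move=> fE; rewrite /d /onestep_defect test_stepE3 !mxE /= fE /ap /q.
by split; field.
Qed.

(** * Taylor expansion of the defects along an exact solution *)

Section Expansion.
Variables (f u : R -> R) (t : R).
Hypotheses (sf : smooth f) (eu : exact_solution xi omega f u).
Let su : smooth u := exact_solution_smooth sf eu.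
Let U k := (u^`(k))%classic t.

Let rem k n (s h : R) := taylor_rem n (u^`(k))%classic t s h.

Lemma remE k n (s h : R) : rem k n s h =
  (u^`(k))%classic (t + s * h) - \sum_(m < n) U (m + k) / m`!%:R * (s * h) ^+ m.
Proof.
rewrite /rem /taylor_rem horner_poly; congr (_ - _); apply: eq_bigr => m _.
by rewrite /U /derive1n iterD.
Qed.

Lemma isBigO_rem k n (s : R) : 0 <= s -> isBigO n (rem k n s).
Proof.
apply: isBigO_taylor_rem; elim: k => [//|k IHk].
by rewrite derive1nS; exact: smooth_derive1.
Qed.

(* Taylor remainder of the difference between the acceleration computed at
   t + (s + p) h and the exact one at t + s h. *)
Let remp n (s h : R) :=
  rem 2 n.+2 (s + p) h - rem 2 n.+2 s h
  + c * (rem 1 n.+2 (s + p) h - rem 1 n.+2 s h - p * h * rem 2 n.+1 s h)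
  + w * (rem 0 n.+2 (s + p) h - rem 0 n.+2 s h - p * h * rem 1 n.+1 s h
         - p ^+ 2 / 2 * h ^+ 2 * rem 2 n s h).

Let d (s h : R) :=
  onestep_defect f (u^`(0))%classic (u^`(1))%classic (u^`(2))%classic (t + s * h) h.

Let fE x :
  f x = (u^`(2))%classic x + c * (u^`(1))%classic x + w * (u^`(0))%classic x.
Proof. by have [_ _ <-] := eu. Qed.

(** Since p q = 1/6, the terms in h^3, h^2 and h of the displacement, velocity and acceleration
    defects vanish; [cu], [cv] and [ca] are the first coefficients left. *)
Let cu := (1 / 24 - p / 12) * U 4 - c * p / 12 * U 3.
Let cv := (1 / 6 - p / 4) * U 4 - c * p / 4 * U 3.
Let cv' := (1 / 6 - p / 4) * U 5 - c * p / 4 * U 4.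
Let cv1 := (1 / 24 - p ^+ 2 / 12) * U 5 - c * p ^+ 2 / 12 * U 4
           - w * p ^+ 2 / 12 * U 3.
Let ca := (1 / 2 - p / 2) * U 4 - c * p / 2 * U 3.
Let ca' := (1 / 2 - p / 2) * U 5 - c * p / 2 * U 4.
Let ca1 := (1 / 6 - p ^+ 2 / 6) * U 5 - c * p ^+ 2 / 6 * U 4
           - w * p ^+ 2 / 6 * U 3.

Ltac expand_defect s h :=
  (have -> : t + s * h + h = t + (s + 1) * h by ring);
  (have -> : t + s * h + p * h = t + (s + p) * h by ring);
  rewrite /cu /cv /cv1 /cv' /ca /ca1 /ca' /remp !remE !big_ord_recr !big_ord0 /q;
  move: ((u^`(0))%classic (t + s * h)) ((u^`(1))%classic (t + s * h))
    ((u^`(2))%classic (t + s * h)) => y0 v0 a0;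
  move: ((u^`(0))%classic (t + (s + 1) * h)) ((u^`(1))%classic (t + (s + 1) * h))
    ((u^`(2))%classic (t + (s + 1) * h)) => y1 v1 a1;
  move: ((u^`(0))%classic (t + (s + p) * h)) ((u^`(1))%classic (t + (s + p) * h))
    ((u^`(2))%classic (t + (s + p) * h)) => yp vp ap;
  let V := fresh in move: U => V; rewrite !factS !fact0 /=;
  move: (V 0%N) (V 1%N) (V 2%N) (V 3%N) (V 4%N) (V 5%N) => V0 V1 V2 V3 V4 V5.

(** An exact identity: remainders are values minus Taylor polynomials, so everything reduces to
    algebra in the abstracted values. Each remainder is cut at an order that, with its power of h,
    reaches h^5. *)
Lemma defect_disp (s h : R) : d s h 0 0 =
  h ^+ 4 * cu
  + (rem 0 5 (s + 1) h - rem 0 5 s h - h * rem 1 4 s h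
     - h ^+ 2 / 2 * rem 2 3 s h - h ^+ 2 * q * remp 1 s h).
Proof.
have [-> _ _] := onestep_defectE (t + s * h) h fE.
expand_defect s h.
by have [r rr ->] := p_rootE; field: rr.
Qed.

Lemma defect_velo (s h : R) : d s h 1 0 =
  h ^+ 3 * (cv + h * (cv1 + s * cv'))
  + (rem 1 5 (s + 1) h - rem 1 5 s h - h * rem 2 4 s h
     - 3 * h * q * remp 2 s h).
Proof.
have [_ -> _] := onestep_defectE (t + s * h) h fE.
expand_defect s h.
by have [r rr ->] := p_rootE; field: rr.
Qed.

Lemma defect_acce (s h : R) : d s h 2 0 =
  h ^+ 2 * (ca + h * (ca1 + s * ca'))
  + (rem 2 4 (s + 1) h - rem 2 4 s h - 6 * q * remp 2 s h).
Proof.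
have [_ _ ->] := onestep_defectE (t + s * h) h fE.
expand_defect s h.
by have [r rr ->] := p_rootE; field: rr.
Qed.

Lemma isBigO_remp1 (s : R) : 0 <= s -> isBigO 3 (remp 1 s).
Proof.
move=> s0; have sp0 : 0 <= s + p by rewrite addr_ge0 // ltW.
have R2p := isBigO_rem 2 3 sp0; have R2 := isBigO_rem 2 3 s0.
have R1p := isBigO_rem 1 3 sp0; have R1 := isBigO_rem 1 3 s0.
have R0p := isBigO_rem 0 3 sp0; have R0 := isBigO_rem 0 3 s0.
have R22 := isBigO_rem 2 2 s0; have R12 := isBigO_rem 1 2 s0.
have R21 := isBigO_rem 2 1 s0.
rewrite /remp; isBigO_auto.
Qed.

Lemma isBigO_remp2 (s : R) : 0 <= s -> isBigO 4 (remp 2 s).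
Proof.
move=> s0; have sp0 : 0 <= s + p by rewrite addr_ge0 // ltW.
have R2p := isBigO_rem 2 4 sp0; have R2 := isBigO_rem 2 4 s0.
have R1p := isBigO_rem 1 4 sp0; have R1 := isBigO_rem 1 4 s0.
have R0p := isBigO_rem 0 4 sp0; have R0 := isBigO_rem 0 4 s0.
have R22 := isBigO_rem 2 3 s0; have R12 := isBigO_rem 1 3 s0.
have R21 := isBigO_rem 2 2 s0.
rewrite /remp; isBigO_auto.
Qed.

Lemma defect_dispO (s : R) : 0 <= s ->
  isBigO 5 (fun h => d s h 0 0 - h ^+ 4 * cu).
Proof.
move=> s0; have s1 : 0 <= s + 1 by rewrite addr_ge0.
have R0p := isBigO_rem 0 5 s1; have R0 := isBigO_rem 0 5 s0.
have R1 := isBigO_rem 1 4 s0; have R2 := isBigO_rem 2 3 s0.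
have Rp := isBigO_remp1 s0.
eapply isBigO_ext; first by move=> h; rewrite defect_disp addrC addKr; reflexivity.
isBigO_auto.
Qed.

Lemma defect_veloO (s : R) : 0 <= s ->
  isBigO 5 (fun h => d s h 1 0 - h ^+ 3 * (cv + h * (cv1 + s * cv'))).
Proof.
move=> s0; have s1 : 0 <= s + 1 by rewrite addr_ge0.
have R1p := isBigO_rem 1 5 s1; have R1 := isBigO_rem 1 5 s0.
have R2 := isBigO_rem 2 4 s0; have Rp := isBigO_remp2 s0.
eapply isBigO_ext; first by move=> h; rewrite defect_velo addrC addKr; reflexivity.
isBigO_auto.
Qed.

Lemma defect_acceO (s : R) : 0 <= s ->
  isBigO 4 (fun h => d s h 2 0 - h ^+ 2 * (ca + h * (ca1 + s * ca'))).
Proof.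
move=> s0; have s1 : 0 <= s + 1 by rewrite addr_ge0.
have R1p := isBigO_rem 2 4 s1; have R1 := isBigO_rem 2 4 s0.
have Rp := isBigO_remp2 s0.
eapply isBigO_ext; first by move=> h; rewrite defect_acce addrC addKr; reflexivity.
isBigO_auto.
Qed.

Let M (h : R) := 1%:M - Dnum p xi omega h.
Let defsum (h : R) := defect_sum (Dnum p xi omega h) (d 0 h) (d 1 h) (d 2 h).

Lemma truncation_errorE (h : R) i :
  truncation_error p xi omega f u t h i 0 = (h ^+ 2)^-1 * defsum h i 0.
Proof.
rewrite /truncation_error /defsum mxE; congr (_ * _).
pose X (k : nat) := state ((u^`(0))%classic (t + k%:R * h))
  ((u^`(1))%classic (t + k%:R * h)) ((u^`(2))%classic (t + k%:R * h)).
pose L (k : nat) := Lnum p xi omega f h (t + k%:R * h).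
have XS (k : nat) : X k.+1 = Dnum p xi omega h *m X k + L k + d k%:R h.
  rewrite -test_stepE /d /onestep_defect addrC subrK -addrA -[X in _ + (_ + X)]mul1r.
  by rewrite -mulrDl natr1.
have := char_poly_sum_defect XS; rewrite -[0%:R]/0 -[1%:R]/1 => <-.
congr ((_ - _ : matrix _ _ _) _ _); apply: eq_big_nat => j j4.
congr (_ *: _); apply: eq_big_nat => k /andP[_ kj].
(* The truncated subtraction i - j - 1 is a true one because j < i. *)
by rewrite /L !natrB ?subn_gt0 // ltnW.
Qed.

Lemma M_orders :
  [/\ isBigO 2 (fun h => M h 0 0), isBigO 1 (fun h => M h 1 0)
    & isBigO 0 (fun h => M h 2 0)] /\
  [/\ isBigO 2 (fun h => M h 0 1 + h), isBigO 1 (fun h => M h 1 1)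
    & isBigO 0 (fun h => M h 2 1)] /\
  [/\ isBigO 2 (fun h => M h 0 2), isBigO 2 (fun h => M h 1 2 + (3 * p - 2) * h)
    & isBigO 1 (fun h => M h 2 2 - 6 * q)].
Proof.
have ME h i j : M h i j = (i == j)%:R - Dnum p xi omega h i j by rewrite !mxE.
have D0 h i := let: And3 e _ _ := Dnum3E h i in e.
have D1 h i := let: And3 _ e _ := Dnum3E h i in e.
have D2 h i := let: And3 _ _ e := Dnum3E h i in e.
do !split.
- apply: (@isBigO_ext _ _ _ (fun h => h ^+ 2 * (q * w))); last isBigO_auto.
  by move=> h; rewrite ME D0 /=; ring.
- apply: (@isBigO_ext _ _ _ (fun h => h * (3 * q * w))); last isBigO_auto.
  by move=> h; rewrite ME D0 /=; ring.
- apply: (@isBigO_ext _ _ _ (fun h => 6 * q * w)); last isBigO_auto.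
  by move=> h; rewrite ME D0 /=; ring.
- apply: (@isBigO_ext _ _ _ (fun h => h ^+ 2 * (q * (c + w * p * h))));
    last isBigO_auto.
  by move=> h; rewrite ME D1 /=; ring.
- apply: (@isBigO_ext _ _ _ (fun h => h * (3 * q * (c + w * p * h))));
    last isBigO_auto.
  by move=> h; rewrite ME D1 /=; ring.
- apply: (@isBigO_ext _ _ _ (fun h => 6 * q * (c + w * p * h)));
    last isBigO_auto.
  by move=> h; rewrite ME D1 /=; ring.
- apply: (@isBigO_ext _ _ _ (fun h => - (h ^+ 2 * (p - 1 / 2
    - q * (c * p * h + w * (p ^+ 2 / 2) * h ^+ 2))))); last isBigO_auto.
  by move=> h; rewrite ME D2 /=; ring.
- apply: (@isBigO_ext _ _ _ (fun h =>
    h * (3 * q * (c * p * h + w * (p ^+ 2 / 2) * h ^+ 2)))); last isBigO_auto.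
  by move=> h; rewrite ME D2 /=; ring.
- apply: (@isBigO_ext _ _ _ (fun h =>
    6 * q * (c * p * h + w * (p ^+ 2 / 2) * h ^+ 2))); last isBigO_auto.
  by move=> h; rewrite ME D2 /= /q; ring.
Qed.

Lemma truncation_orders :
  [/\ isBigO 4 (fun h => defsum h 0 0), isBigO 4 (fun h => defsum h 1 0)
    & isBigO 4 (fun h => defsum h 2 0)] /\
  (c = 0 -> isBigO 5 (fun h => defsum h 0 0) /\ isBigO 5 (fun h => defsum h 1 0)).
Proof.
have [M0 [M1 M2]] := M_orders.
pose dd (k : nat) := d k%:R.
have du k : isBigO 5 (fun h => dd k h 0 0 - h ^+ 4 * cu).
  exact: (@defect_dispO k%:R (ler0n _ k)).
have dv k : isBigO 5 (fun h => dd k h 1 0 - h ^+ 3 * (cv + h * (cv1 + k%:R * cv'))).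
  exact: (@defect_veloO k%:R (ler0n _ k)).
have da k : isBigO 4 (fun h => dd k h 2 0 - h ^+ 2 * (ca + h * (ca1 + k%:R * ca'))).
  exact: (@defect_acceO k%:R (ler0n _ k)).
have [SO S0 S1] := defect_sum_orders M0 M1 M2 du dv da.
split=> [//|c0]; split; [apply: S0|apply: S1].
  (* For general [c] the combination is - (c p / 2) [U 3], and in the velocity case - (c p / 2)
     [U 4]: only damping contributes. *)
  rewrite /cv /ca /q c0; have [r rr ->] := p_rootE.
  by move: (U 3) (U 4) => U3 U4; field: rr.
rewrite /cv' /ca' /q c0; have [r rr ->] := p_rootE.
by move: (U 4) (U 5) => U4 U5; field: rr.
Qed.

Local Open Scope classical_set_scope.

Lemma truncation_error_eqO i n : isBigO (2 + n) (fun h => defsum h i 0) ->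
  (fun h => truncation_error p xi omega f u t h i 0 : R^o)
    =O_ (0^'+) (fun h : R => h ^+ n : R^o).
Proof. by move=> /isBigO_eqO; apply => h; exact: truncation_errorE. Qed.

End Expansion.

(** * Orders of accuracy *)

Lemma identically_accurate_order2 : identically_accurate p xi omega 2.
Proof.
move=> i f u sf eu t; apply: truncation_error_eqO.
have [[S0 S1 S2] _] := truncation_orders t sf eu.
have [->|->|->] // : [\/ i = 0, i = 1 | i = 2].
by case: i => [[|[|[|//]]] ?];
  [apply: Or31|apply: Or32|apply: Or33]; exact/val_inj.
Qed.

Lemma accurate_disp_order3 : c = 0 -> accurate p xi omega disp 3.
Proof.
move=> c0 f u sf eu t; apply: truncation_error_eqO.
by have [_ /(_ c0)[]] := truncation_orders t sf eu.
Qed.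

Lemma accurate_velo_order3 : c = 0 -> accurate p xi omega velo 3.
Proof.
move=> c0 f u sf eu t; apply: truncation_error_eqO.
by have [_ /(_ c0)[]] := truncation_orders t sf eu.
Qed.

End Defect.

Theorem mainTheorem2 (R : realType) (omega : R) (omega_gt0 : 0 < omega) :
  [/\ accurate (alg1_p R) 0 omega disp 3,
      accurate (alg1_p R) 0 omega velo 3
    & accurate (alg1_p R) 0 omega acce 2]
  /\ (forall xi : R, 0 < xi < 1 -> identically_accurate (alg1_p R) xi omega 2).
Proof.
have c0 : 2 * 0 * omega = 0 by rewrite mulr0 mul0r.
have p0 := alg1_p_gt0 R; have pr := alg1_p_root R.
split; last by move=> xi _; exact: identically_accurate_order2.
split; [exact: accurate_disp_order3|exact: accurate_velo_order3|].
exact: identically_accurate_order2.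
Qed.
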